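(* Let $I$ be a set and let $\{G_i:i\in I\}$ be a family of finite groups, each with the discrete topology. Then for every subgroup $H$ of the direct product $G=\prod_{i\in I}G_i$ (with the Tychonoff product topology) the following conditions are equivalent: (i) $H$ is weakly controllable in $G$; (ii) $H$ is controllable in $G$; (iii) $H$ is uniformly controllable in $G$.
   Context: For a family of groups $\{G_i:i\in I\}$ with direct product $G=\prod_{i\in I}G_i$ and $K\subseteq I$, $\bigoplus_{i\in K}G_i$ denotes the subgroup of $G$ consisting of all $g\in G$ such that $g(i)$ is the identity of $G_i$ for all but finitely many $i\in I$ and for every $i\in I\setminus K$. For $J\subseteq I$, $p_{IJ}:\prod_{i\in I}G_i\to\prod_{j\in J}G_j$ is the projection $g\mapsto g\restriction_J$. A subgroup $H$ of $G$ is: controllable in $G$ if $p_{IJ}(H)=p_{IJ}(H\cap\bigoplus_{i\in I}G_i)$ for every finite set $J\subseteq I$; uniformly controllable in $G$ if for every finite set $J\subseteq I$ there exists a finite set $K\subseteq I$ such that $p_{IJ}(H)=p_{IJ}(H\cap\bigoplus_{i\in K}G_i)$; weakly controllable in $G$ (when the $G_i$ are topological groups and $G$ has the Tychonoff product topology) if $H\cap\bigoplus_{i\in I}G_i$ is dense in $H$. *)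

(* Defs.v *)
From HB Require Import structures.
From mathcomp Require Import all_boot all_fingroup.
From mathcomp Require Import all_classical all_reals topology.

Set Implicit Arguments.
Unset Strict Implicit.
Unset Printing Implicit Defensive.

Local Open Scope classical_set_scope.
Local Open Scope group_scope.

HB.mixin Record isTopologicalGroup G & monoid.Group G & Topological G := {
  mulg_continuous : continuous (fun x : G * G => x.1 * x.2) ;
  invg_continuous : continuous (fun x : G => x^-1)
}.

#[short(type="topologicalGroupType")]
HB.structure Definition TopologicalGroup :=
  {G of monoid.Group G & Topological G & isTopologicalGroup G}.

Section DiscreteGroup.
Variable T : groupType.

HB.instance Definition _ := monoid.Group.copy (discrete_topology T) T.

Let D : Type := discrete_topology T.

Lemma discrete_mulg_continuous : continuous (fun x : D * D => x.1 * x.2).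
Proof.
move=> x A; rewrite nbhs_principalE /= => xA.
exists ([set x.1], [set x.2]); first by split; rewrite /= nbhs_principalE.
by move=> [a b] [/= -> ->]; exact: xA.
Qed.

Lemma discrete_invg_continuous : continuous (fun x : D => x^-1).
Proof. by move=> x A; rewrite !nbhs_principalE /= => xA y ->; exact: xA. Qed.

HB.instance Definition _ := isTopologicalGroup.Build (discrete_topology T)
  discrete_mulg_continuous discrete_invg_continuous.

End DiscreteGroup.

Section ProductGroup.
Variables (I : Type) (G : I -> groupType).
Implicit Types f g : prod_topology G.

Definition prod_oneg : prod_topology G := fun=> 1.
Definition prod_invg f : prod_topology G := fun i => (f i)^-1.
Definition prod_mulg f g : prod_topology G := fun i => f i * g i.

Lemma prod_mulgA : associative prod_mulg.
Proof.
by move=> f g h; apply: functional_extensionality_dep => i; exact: mulgA.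
Qed.
Lemma prod_mul1g : left_id prod_oneg prod_mulg.
Proof.
by move=> f; apply: functional_extensionality_dep => i; exact: mul1g.
Qed.
Lemma prod_mulg1 : right_id prod_oneg prod_mulg.
Proof.
by move=> f; apply: functional_extensionality_dep => i; exact: mulg1.
Qed.
Lemma prod_mulVg : left_inverse prod_oneg prod_invg prod_mulg.
Proof.
by move=> f; apply: functional_extensionality_dep => i; exact: mulVg.
Qed.
Lemma prod_mulgV : right_inverse prod_oneg prod_invg prod_mulg.
Proof.
by move=> f; apply: functional_extensionality_dep => i; exact: mulgV.
Qed.

HB.instance Definition _ := isGroup.Build (prod_topology G)
  prod_mulgA prod_mul1g prod_mulg1 prod_mulVg prod_mulgV.

End ProductGroup.

Definition direct_sum (I : Type) (G : I -> groupType) (K : set I) :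
    set (prod_topology G) :=
  [set g | finite_set [set i | g i <> 1] /\ forall i, ~ K i -> g i = 1].

Arguments direct_sum {I} G K _.

Definition restr_proj (I : Type) (G : I -> groupType) (J : set I)
    (g : prod_topology G) : prod_topology (fun j : J => G (set_val j)) :=
  fun j => g (set_val j).

Arguments restr_proj {I} G J g.

Section Controllability.
Variables (I : Type) (G : I -> groupType).
Implicit Types (H : set (prod_topology G)) (J K : set I).

Definition controllable H := forall J, finite_set J ->
  restr_proj G J @` H = restr_proj G J @` (H `&` direct_sum G setT).

Definition uniformly_controllable H := forall J, finite_set J ->
  exists2 K, finite_set K &
    restr_proj G J @` H = restr_proj G J @` (H `&` direct_sum G K).

End Controllability.

(* Density in H, not in the whole product: the set H coerces to the type
   [set_type H], whose topology is the subspace topology. *)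
Definition weakly_controllable (I : Type) (G : I -> topologicalGroupType)
    (H : set (prod_topology G)) :=
  dense [set h : H | direct_sum G setT (set_val h)].

(* Main.v *)
Require Import Defs.
From mathcomp Require Import all_boot all_fingroup.
From mathcomp Require Import all_classical all_reals topology.

Local Open Scope classical_set_scope.
Local Open Scope group_scope.

(** Controllability says that, on any finite set [J] of coordinates, each element
    of [H] coincides with an element of [H] of finite support; the uniform version
    asks moreover for a finite set containing these supports that depends on [J]
    only.

    Since the factors are discrete, the sets of all [g] that agree with a given
    [h] on a finite [J] form a base of neighbourhoods of [h] in the product
    ([nbhs_prod_discreteP]).  Meeting all these neighbourhoods of every point of
    [H] is density of the finitely supported elements in [H], so weak
    controllability and controllability are the same
    ([weakly_controllableP]).

    Controllability yields the uniform version because the factors are finite: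
    the elements of [H] have only finitely many restrictions to [J], hence
    finitely many elements of finite support realise all of these
    restrictions ([finite_representatives]), and the union of their supports is
    a finite [K] that serves every element of [H] at once. *)

Section Agreement.
Variables (I : Type) (G : I -> groupType).

Lemma restr_proj_eqP (J : set I) (f g : prod_topology G) :
  restr_proj G J f = restr_proj G J g <-> forall i, J i -> f i = g i.
Proof.
split=> [fg i Ji|fg]; first exact: (congr1 (@^~ (SigSub (mem_set Ji))) fg).
by apply: functional_extensionality_dep => j; apply/fg/set_valP.
Qed.

Lemma restr_proj_image_setIP (J : set I) (A P : set (prod_topology G)) :
  restr_proj G J @` A = restr_proj G J @` (A `&` P) <->
  forall a, A a -> exists2 b, (A `&` P) b & forall i, J i -> b i = a i.
Proof.
split=> [AP a Aa|AP].
  have [b bAP /restr_proj_eqP ba] :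
    (restr_proj G J @` (A `&` P)) (restr_proj G J a) by rewrite -AP; exists a.
  by exists b.
apply/seteqP; split=> _ [a aP <-]; last by exists a => //; case: aP.
by have [b bAP /restr_proj_eqP ba] := AP a aP; exists b.
Qed.

End Agreement.

(** The filter generated by the sets on the right converges to [f] in each of
    the initial topologies whose supremum is the product topology, hence it
    contains every neighbourhood of [f]. Conversely, fixing one coordinate is an
    open condition because the factors are discrete. *)
Lemma nbhs_prod_discreteP (I : Type) (T : I -> discreteTopologicalType)
    (f : prod_topology T) (A : set (prod_topology T)) :
  nbhs f A <->
  exists2 J, finite_set J & [set g | forall i, J i -> g i = f i] `<=` A.
Proof.
elim/Pchoice: I => I in T f A *.
pose agree (J : set I) := [set g : prod_topology T | forall i, J i -> g i = f i].
split=> [fA|[J]].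
  pose F : set_system (prod_topology T) := filter_from finite_set agree.
  have FF : Filter F.
    apply: filter_from_filter => [|J K finJ finK]; first by exists set0.
    exists (J `|` K); first by rewrite finite_setU.
    by move=> g gJK; split=> i ?; apply: gJK; [left|right].
  suff : F --> f by apply.
  apply/cvg_sup => i B [_ [[W Wopen <-] Wf] WB].
  exists [set i]; first exact: finite_set1.
  by move=> g /(_ i erefl) gf; apply: WB; rewrite /= gf.
have coord_nbhs i : nbhs f [set g : prod_topology T | g i = f i].
  have /cvg_sup/(_ i) : nbhs f --> f by exact: cvg_id.
  apply; exists [set g : prod_topology T | g i = f i].
  split; [|by []|exact: subset_refl].
  by exists [set f i] => //; exact: discrete_open.
move=> /finite_fsetP[X ->]; have nbhs_fF := nbhs_filter f.
by move=> /filterS; apply; apply: filter_bigI => i _; exact: coord_nbhs.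
Qed.

(** Values at one new coordinate split [A] into finitely many fibres, and
    each fibre has finitely many representatives by induction on [J]. *)
Lemma finite_representatives (I : Type) (T : I -> finType) (J : set I)
    (A : set (prod_topology T)) :
  finite_set J ->
  exists F, [/\ finite_set F, F `<=` A &
    forall a, A a -> exists2 f, F f & forall i, J i -> f i = a i].
Proof.
elim/Pchoice: I => I in T J A *.
move=> /finite_seqP[s ->]; elim: s A => [|i s IHs] A.
  have [->|/set0P[a Aa]] := eqVneq A set0; first by exists set0; split.
  exists [set a]; split; [exact: finite_set1|by move=> _ ->|].
  by move=> b _; exists a.
pose fibre v := A `&` [set a | a i = v].
have /choice[F FP] v := IHs (fibre v).
exists (\bigcup_(v in [set: T i]) F v); split.
- by apply: bigcup_finite => // v _; have [] := FP v.
- by move=> f [v _]; have [_ sF _] := FP v => /sF[].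
move=> a Aa; have [_ sF /(_ a (conj Aa erefl))[f Ff fa]] := FP (a i).
exists f; first by exists (a i).
move=> j; rewrite /= inE => /orP[/eqP ->|]; last exact: fa.
by have [] := sF f Ff.
Qed.

Section Equivalences.
Variable (I : Type).

(** An open set of [H] is the trace of an open set of the product, so the density
    of the finitely supported elements has to be tested only on the traces of the
    basic neighbourhoods given by [nbhs_prod_discreteP]. *)
Lemma weakly_controllableP (G : I -> groupType)
    (H : set (prod_topology (fun i => discrete_topology (G i)))) :
  weakly_controllable H <-> controllable H.
Proof.
split=> [Hdense J finJ|Hctrl O [h Oh] [U Uopen UO]].
  apply/restr_proj_image_setIP => h Hh.
  pose agree := [set g : prod_topology (fun i => discrete_topology (G i)) |
                 forall i, J i -> g i = h i].
  have /nbhs_interior : nbhs h agree by apply/nbhs_prod_discreteP; exists J.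
  move=> /nbhs_singleton hagree.
  have [||g [/interior_subset gh gsum]] :=
    Hdense (set_val @^-1` agree°).
  - by exists (SigSub (mem_set Hh)).
  - by exists agree° => //; exact: open_interior.
  by exists (set_val g) => //; split=> //; exact: set_valP.
have : nbhs (set_val h) U.
  by apply: open_nbhs_nbhs; split=> //; rewrite -UO in Oh.
move=> /nbhs_prod_discreteP[J finJ sJU].
have /restr_proj_image_setIP Hg := Hctrl J finJ.
have [g [gH gsum] /sJU Ug] := Hg _ (set_valP h).
by exists (SigSub (mem_set gH)); split=> //; rewrite -UO.
Qed.

(** Representatives are taken among the finitely supported elements of [H], not
    among all of [H], so that the union of their supports is finite. *)
Lemma controllable_uniformly (G : I -> finGroupType)
    (H : set (prod_topology G)) :
  controllable H -> uniformly_controllable H.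
Proof.
move=> Hctrl J finJ.
have /restr_proj_image_setIP Hg := Hctrl J finJ.
have [F [finF sF FP]] :=
  finite_representatives I G J (H `&` direct_sum G setT) finJ.
pose K := \bigcup_(f in F) [set i | f i <> 1].
exists K; first by apply: bigcup_finite => // f /sF[_ []].
apply/restr_proj_image_setIP => h /Hg[g /FP[f Ff fg] gh].
have [Hf [ffin _]] := sF f Ff.
exists f; last by move=> i Ji; rewrite fg// gh.
split=> //; split=> // i Ki; apply: contrapT => fi.
by apply: Ki; exists f.
Qed.

Lemma uniformly_controllableW (G : I -> groupType)
    (H : set (prod_topology G)) :
  uniformly_controllable H -> controllable H.
Proof.
move=> Huni J finJ; have [K _ HK] := Huni J finJ.
have /restr_proj_image_setIP Hg := HK.
apply/restr_proj_image_setIP => h /Hg[g [gH [gfin _]] gh].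
by exists g => //; split=> //; split=> // i /(_ Logic.I).
Qed.

End Equivalences.

Theorem corollary2p3 (I : Type) (G : I -> finGroupType)
    (H : set (prod_topology (fun i => discrete_topology (G i)))) :
  group_closed (mem H) ->
  (weakly_controllable H <-> controllable H) /\
  (controllable H <-> uniformly_controllable H).
Proof.
move=> _; split; first exact: weakly_controllableP.
split; [exact: controllable_uniformly|exact: uniformly_controllableW].
Qed.
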